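(* Let $N\ge 1$ be an integer. For every $\alpha=(\alpha_1,\dots,\alpha_N)\in\mathbb{R}^N$, every collection $Y=\{y_1,\dots,y_N\}$ of $N$ distinct points in $\mathbb{R}^3$, and every $z\in\mathbb{R}\setminus\{0\}$, the $N\times N$ matrix $\Gamma_{\alpha,Y}(z)$ is non-singular. Equivalently, the self-adjoint operator $-\Delta_{\alpha,Y}$ on $L^2(\mathbb{R}^3)$ has no real positive resonances, that is, for no $z\in\mathbb{R}\setminus\{0\}$ does $-\Delta_{\alpha,Y}$ have a resonance at $z^2$.
   Context: For $z\in\mathbb{C}$ and $x,y,y'\in\mathbb{R}^3$ set $$\mathcal{G}_z^{y}(x):=\frac{e^{\mathrm{i}z|x-y|}}{4\pi|x-y|},\qquad \mathcal{G}_z^{yy'}:=\begin{cases}\dfrac{e^{\mathrm{i}z|y-y'|}}{4\pi|y-y'|} & \text{if } y'\ne y,\\ 0 & \text{if } y'=y,\end{cases}$$ and, for $\alpha\in\mathbb{R}^N$ and $Y=\{y_1,\dots,y_N\}\subset\mathbb{R}^3$ a collection of $N$ distinct points, define the $N\times N$ complex symmetric matrix $$\Gamma_{\alpha,Y}(z):=\Big(\big(\alpha_j-\tfrac{\mathrm{i}z}{4\pi}\big)\delta_{j,k}-\mathcal{G}_z^{y_jy_k}\Big)_{j,k=1,\dots,N},$$ where $\delta_{j,k}$ is the Kronecker delta. The map $z\mapsto\Gamma_{\alpha,Y}(z)$ is entire and $z\mapsto\Gamma_{\alpha,Y}(z)^{-1}$ is meromorphic on $\mathbb{C}$; let $\mathcal{E}_{\alpha,Y}^+$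 be the set of its poles in the open upper half-plane $\mathbb{C}^+$. The operator $-\Delta_{\alpha,Y}$ (Schrödinger operator with point interactions at $Y$): fix $z\in\mathbb{C}^+\setminus\mathcal{E}_{\alpha,Y}^+$. Its domain is the set of all $u\in L^2(\mathbb{R}^3)$ of the form $$u=F_z+\sum_{j,k=1}^N(\Gamma_{\alpha,Y}(z)^{-1})_{jk}\,F_z(y_k)\,\mathcal{G}_z^{y_j}\quad\text{for some } F_z\in H^2(\mathbb{R}^3),$$ and its action is $(-\Delta_{\alpha,Y}-z^2\mathbf{1})u=(-\Delta-z^2\mathbf{1})F_z$, where $\mathbf{1}$ denotes the identity operator. For each fixed $z$ the decomposition is unique, and the domain and the action do not depend on the choice of $z$; the operator $-\Delta_{\alpha,Y}$ is self-adjoint on $L^2(\mathbb{R}^3)$. Definition of resonance: for $z\in\mathbb{C}$, the operator $-\Delta_{\alpha,Y}$ is said to have a resonance at $z^2$ if the matrix $\Gamma_{\alpha,Y}(z)$ is singular but $z^2$ is not an eigenvalue of $-\Delta_{\alpha,Y}$. It is known that $-\Delta_{\alpha,Y}$ has no positive eigenvalues. *)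

(* Defs.v *)
From HB Require Import structures.
From mathcomp Require Import all_boot all_order all_algebra.
From mathcomp Require Import all_classical all_reals all_analysis.
From mathcomp Require Export complex.

Set Implicit Arguments.
Unset Strict Implicit.
Unset Printing Implicit Defensive.

Import Order.TTheory GRing.Theory Num.Theory numFieldNormedType.Exports.

Local Open Scope classical_set_scope.
Local Open Scope ring_scope.

Section PointInteractions.
Variable R : realType.

Local Notation C := R[i].
Local Notation Re := (@complex.Re R).
Local Notation Im := (@complex.Im R).
Local Notation R3 := (R * R * R)%type.

Definition cexp (z : C) : C :=
  Complex (expR (Re z) * cos (Im z)) (expR (Re z) * sin (Im z)).

(* The library norm on [R * R * R] is the sup norm: it gives the right
   topology, but distances must be Euclidean. *)
Definition edist (x y : R3) : R :=
  Num.sqrt ((x.1.1 - y.1.1) ^+ 2 + (x.1.2 - y.1.2) ^+ 2 + (x.2 - y.2) ^+ 2).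

Definition mu3 :=
  (@lebesgue_measure R \x @lebesgue_measure R \x @lebesgue_measure R)%E.

(* Value at [x = y] is irrelevant (a null set): it is 0 as [x / 0 = 0]. *)
Definition green (z : C) (y x : R3) : C :=
  cexp ('i%C * z * (edist x y)%:C%C) / (4 * pi * edist x y)%:C%C.

Definition green_off (z : C) (y y' : R3) : C :=
  if y' == y then 0 else green z y y'.

Definition Gamma (N : nat) (alpha : 'I_N -> R) (Y : 'I_N -> R3) (z : C)
    : 'M[C]_N :=
  \matrix_(j, k) (((alpha j)%:C%C - 'i%C * z / (4 * pi)%:C%C) *+ (j == k)
                  - green_off z (Y j) (Y k)).

(* A matrix-valued meromorphic function has a pole where some entry has one,
   i.e. where the modulus of that entry tends to infinity. The values of
   [invmx] at singular matrices play no role: in a punctured neighbourhood of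
   any point [Gamma] is invertible. *)
Definition is_pole (N : nat) (M : C -> 'M[C]_N) (z0 : C) : Prop :=
  exists j k : 'I_N, `|M z j k| @[z --> (z0 : C^o)^'] --> +oo.

Definition invGamma (N : nat) (alpha : 'I_N -> R) (Y : 'I_N -> R3) (z : C)
    : 'M[C]_N :=
  invmx (Gamma alpha Y z).

Definition upper_poles (N : nat) (alpha : 'I_N -> R) (Y : 'I_N -> R3) : set C :=
  [set z | 0 < Im z /\ is_pole (invGamma alpha Y) z].

(* Elements of L^2(R^3; C) are represented by functions, equality in L^2 being
   [eqae]. *)
Definition L2 (f : R3 -> C) : Prop :=
  Re \o f \in Lfun mu3 2%:E /\ Im \o f \in Lfun mu3 2%:E.

Definition eqae (f g : R3 -> C) : Prop := \forall x \ae mu3, f x = g x.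

Definition basis3 (i : 'I_3) : R3 :=
  ((i == 0%N :> nat)%:R, (i == 1%N :> nat)%:R, (i == 2%N :> nat)%:R).

Definition partials (s : seq 'I_3) (f : R3 -> R) : R3 -> R :=
  foldr (fun i (g : R3 -> R) x => 'D_(basis3 i) g x) f s.

Definition test_function (phi : R3 -> R) : Prop :=
  [/\ forall s, continuous (partials s phi),
      forall s i x, derivable (partials s phi) x (basis3 i) &
      compact (closure [set x | phi x != 0])].

(* [g] is the weak derivative of [f] along the directions listed in [s]. By
   linearity it is enough to test against real-valued functions. *)
Definition weak_deriv (s : seq 'I_3) (f g : R3 -> C) : Prop :=
  forall phi, test_function phi ->
    \int[mu3]_x (Re (f x) * partials s phi x)
      = (-1) ^+ size s * \int[mu3]_x (Re (g x) * phi x) /\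
    \int[mu3]_x (Im (f x) * partials s phi x)
      = (-1) ^+ size s * \int[mu3]_x (Im (g x) * phi x).

(* H^2(R^3; C), each class being represented by its unique continuous
   representative, so that point evaluations make sense. *)
Definition H2 (f : R3 -> C) : Prop :=
  [/\ continuous (f : R3 -> C^o), L2 f &
      forall s : seq 'I_3, (size s <= 2)%N -> exists2 g, L2 g & weak_deriv s f g].

Definition is_laplacian (f Lf : R3 -> C) : Prop :=
  exists2 g : 'I_3 -> R3 -> C,
    forall i, L2 (g i) /\ weak_deriv [:: i; i] f (g i) &
    forall x, Lf x = \sum_i g i x.

(* Graph of -Delta_{alpha,Y}: [pointop alpha Y w u v] means that [u] is in the
   domain and is mapped to [v], both being expressed with the spectral
   parameter [w], in the open upper half-plane and not in [upper_poles]. *)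
Definition pointop (N : nat) (alpha : 'I_N -> R) (Y : 'I_N -> R3) (w : C)
    (u v : R3 -> C) : Prop :=
  [/\ L2 u, L2 v &
   exists F LF : R3 -> C,
    [/\ H2 F, is_laplacian F LF,
        eqae u (fun x => F x + \sum_(j < N) \sum_(k < N)
                  invGamma alpha Y w j k * F (Y k) * green w (Y j) x) &
        eqae (fun x => v x - w ^+ 2 * u x)
             (fun x => - LF x - w ^+ 2 * F x)]].

Definition eigenvalue_of (A : (R3 -> C) -> (R3 -> C) -> Prop) (lambda : C)
    : Prop :=
  exists2 u, ~ eqae u (fun=> 0) & A u (fun x => lambda * u x).

(* Resonance of -Delta_{alpha,Y} at [z ^+ 2]. *)
Definition resonance_at_sqr (N : nat) (alpha : 'I_N -> R) (Y : 'I_N -> R3)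
    (w z : C) : Prop :=
  Gamma alpha Y z \notin unitmx /\
  ~ eigenvalue_of (pointop alpha Y w) (z ^+ 2).

End PointInteractions.

(* Main.v *)
Require Import Defs.
From mathcomp Require Import all_boot all_order all_algebra.
From mathcomp Require Import all_classical all_reals all_analysis.
From mathcomp Require Import complex ring lra zify.

(** For real z <> 0, the imaginary part of Gamma(z) is - z / (4 pi) times the
    matrix S_jk = sinc (z |y_j - y_k|), while its real part is symmetric. If
    v Gamma(z) = 0, taking the imaginary part of v Gamma(z) v^* shows that the
    quadratic form of S vanishes at v. So everything rests on the strict
    positive definiteness of S for distinct points ([sinc_form_eq0]); the
    absence of positive resonances follows, a resonance requiring a singular
    matrix.

    Positivity comes from the fact that sinc |x| is the mean of exp (i w . x)
    over the unit sphere, so that the form at a is the mean square of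
    f(w) = sum_j a_j exp (i w . y_j) ([cvg_sinc_form]). If it vanishes, f is
    orthogonal to all functions on the sphere, in particular to the sectoral
    harmonics Re (w_1 + i w_2)^(2m). By the Funk-Hecke formula
    ([cvg_sphere_avg_sectoral_cos]) this reads
    sum_j a_j Re (y_j1 + i y_j2)^(2m) * g_m(|y_j|^2) = 0 for all m, where the
    normalised radial profile g_m tends to 1 pointwise ([cvg_profile_1]). As S
    depends on differences and distances only, the points can be moved so that
    one of them, carrying a nonzero coefficient, lies on the first axis and is
    strictly farther from the origin than the others; letting m grow, its
    coefficient must be 0, a contradiction.

    Means over the sphere are replaced by limits of finite averages
    ([sphere_avg]): roots of unity on each parallel, where monomials are
    averaged exactly once the order is large ([sum_prim_root_moment]), and
    Riemann sums in the height, by Archimedes' theorem. Their limits on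
    polynomials are explicit ([cvg_sphere_moment]), and Tannery's theorem
    ([tannery]) extends them to plane waves. *)

Set Implicit Arguments.
Unset Strict Implicit.
Unset Printing Implicit Defensive.

Import Order.TTheory GRing.Theory Num.Theory numFieldNormedType.Exports.

Local Open Scope classical_set_scope.
Local Open Scope ring_scope.

(** * Tannery's theorem *)

Section Analysis.
Variable R : realType.
Implicit Types (u v mu B : nat -> R).

Lemma cvgn_sum (I : Type) (s : seq I) (P : pred I) (f : I -> nat -> R)
    (l : I -> R) :
  (forall i, P i -> f i @ \oo --> l i) ->
  ((fun n => \sum_(i <- s | P i) f i n) @ \oo --> \sum_(i <- s | P i) l i).
Proof. by move=> fl; apply: cvg_big => //; exact: add_continuous. Qed.

Lemma series_dist_tail v B (V : R) d :
  (forall n, `|v n| <= B n) -> cvgn (series B) ->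
  (series v @ \oo --> V) ->
  `|V - series v d| <= limn (series B) - series B d.
Proof.
move=> vB cB vV.
have B0 n : 0 <= B n by exact: le_trans (vB n).
have ndB : nondecreasing_seq (series B).
  by apply/nondecreasing_series => n _ _.
have cvd : ((fun n => `|series v n - series v d|) @ \oo --> `|V - series v d|).
  by apply: cvg_norm; apply: cvgB => //; exact: cvg_cst.
apply: (cvgr_to_le cvd); exists d => // n /= dn.
apply: (@le_trans _ _ (series B n - series B d)); last first.
  by rewrite lerB // nondecreasing_cvgn_le.
have sub (w : nat -> R) : series w n - series w d = \sum_(d <= k < n) w k.
  exact: sub_series_geq.
by rewrite !sub; apply: le_trans (ler_norm_sum _ _ _) _; exact: ler_sum.
Qed.

(** Dominated convergence for series: past an index [d] that works for [B],
    the tails of all the series are small at once, and only the finitely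
    many terms before [d] have to converge. *)
Lemma tannery (u : nat -> nat -> R) mu B (U : nat -> R) :
  (forall n, u^~ n @ \oo --> mu n) ->
  (forall r n, `|u r n| <= B n) -> cvgn (series B) ->
  (forall r, series (u r) @ \oo --> U r) ->
  (U @ \oo --> limn (series mu)).
Proof.
move=> umu uB cB uU.
have muB n : `|mu n| <= B n.
  by apply: (cvgr_to_le (cvg_norm (umu n))); apply: nearW => r; exact: uB.
have cmu : cvgn (series mu).
  apply: normed_cvg; apply: series_le_cvg cB => n //=.
  exact: le_trans (uB 0 n).
apply/cvgrPdist_lt => e e0.
have e4 : 0 < e / 4 by rewrite divr_gt0.
have [d _ /(_ d (leqnn d)) tail] : \forall d \near \oo,
    limn (series B) - series B d < e / 4.
  move/cvgrPdist_lt: cB => /(_ _ e4); apply: filterS => d /=.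
  exact/le_lt_trans/ler_norm.
have cd : ((series (u r) d) @[r --> \oo] --> series mu d).
  by rewrite /series /=; apply: cvgn_sum => i _.
move/cvgrPdist_lt: cd => /(_ _ e4); apply: filterS => r /= rd.
have t1 := series_dist_tail d muB cB cmu.
have t2 := series_dist_tail d (uB r) cB (uU r).
move: rd t1 t2; rewrite !ltr_norml !ler_norml.
by move=> /andP[? ?] /andP[? ?] /andP[? ?]; apply/andP; split; lra.
Qed.

End Analysis.

(** * Riemann sums of t^c on [0, 1] *)

(** The increment of x^(c+1) on [b, b+1] lies between the extreme values of
    its derivative. Telescoping then encloses the sums of powers and gives
    the integral of t^c without any integration theory. *)
Lemma expnS_increment (c b : nat) :
  (c.+1 * b ^ c <= b.+1 ^ c.+1 - b ^ c.+1 <= c.+1 * b.+1 ^ c)%N.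
Proof.
rewrite subn_exp subSnn mul1n /=.
have cst x : (c.+1 * x = \sum_(i < c.+1) x)%N by rewrite sum_nat_const card_ord.
have split x (i : 'I_c.+1) : (x ^ c = x ^ (c - i) * x ^ i)%N.
  by rewrite -expnD subnK // -ltnS.
have mono k : (b ^ k <= b.+1 ^ k)%N by case: k => // k; rewrite leq_exp2r.
by rewrite !cst; apply/andP; split; apply: leq_sum => i _;
  rewrite (split _ i) leq_mul.
Qed.

Section Heights.
Variable R : realType.

(** A left Riemann sum of [f] on [0, 1]. By Archimedes' theorem the height
    of a uniform random point of the sphere is uniform, hence the name. *)
Definition height_avg (r : nat) (f : R -> R) : R :=
  r.+1%:R^-1 * \sum_(b < r.+1) f (b%:R / r.+1%:R).

Lemma cvg_height_avg_pow c :
  (fun r => height_avg r (fun t => t ^+ c)) @ \oo --> (c.+1%:R^-1 : R).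
Proof.
have sandwich M : (c.+1 * (\sum_(b < M) b ^ c) <= M ^ c.+1
    <= c.+1 * (\sum_(b < M) b ^ c + M ^ c))%N.
  elim: M => [|M /andP[IH1 IH2]]; first by rewrite big_ord0 exp0n // muln0.
  rewrite big_ord_recr /=; have /andP[] := expnS_increment c M.
  have le1 : (M ^ c.+1 <= M.+1 ^ c.+1)%N by rewrite leq_exp2r.
  rewrite !mulnDr in IH2 *.
  move: le1 IH1 IH2; set X := (M.+1 ^ c.+1)%N; set Y := (M ^ c.+1)%N.
  set P := (c.+1 * _ ^ c)%N; set Q := (c.+1 * _.+1 ^ c)%N.
  set S := (c.+1 * _)%N; lia.
have avgE r : height_avg r (fun t => t ^+ c) =
    (\sum_(b < r.+1) b ^ c)%N%:R / r.+1%:R ^+ c.+1.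
  rewrite /height_avg natr_sum exprS invfM mulrCA mulr_suml; congr (_ * _).
  by apply: eq_bigr => b _; rewrite expr_div_n natrX.
apply: (@squeeze_cvgr _ _ _ _ (fun r => c.+1%:R^-1 - r.+1%:R^-1)
          (fun=> c.+1%:R^-1)).
- apply: nearW => r; have /andP[h1 h2] := sandwich r.+1.
  have c0 : (0 : R) < c.+1%:R by rewrite ltr0n.
  have r0 : (0 : R) < r.+1%:R by rewrite ltr0n.
  rewrite avgE; apply/andP; split.
    rewrite ler_pdivlMr ?exprn_gt0 // mulrBl.
    rewrite exprS mulKf ?gt_eqF // -exprS lerBlDr mulrC ler_pdivrMr //.
    by rewrite -!natrX -natrD -natrM ler_nat mulnC.
  rewrite ler_pdivrMr ?exprn_gt0 // mulrC ler_pdivlMr //.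
  by rewrite -!natrX -natrM ler_nat mulnC.
- rewrite -[X in _ --> X]subr0; apply: cvgB; first exact: cvg_cst.
  exact: cvg_harmonic.
- exact: cvg_cst.
Qed.

(** The integral of (1 - t^2)^A t^(2e) over [0, 1], that is half the Beta
    function at (A + 1, e + 1/2). *)
Definition height_moment (A e : nat) : R :=
  4 ^+ A * A`!%:R * (A + e)`!%:R * e.*2`!%:R
  / (e`!%:R * (A + e).*2.+1`!%:R).

Lemma natf_fact_neq0 n : n`!%:R != 0 :> R.
Proof. by rewrite pnatr_eq0 -lt0n fact_gt0. Qed.

(** This recurrence is what makes the closed form provable by induction on
    [A]: it mirrors (1 - t^2)^(A+1) = (1 - t^2)^A - (1 - t^2)^A t^2. *)
Lemma height_momentS A e :
  height_moment A.+1 e = height_moment A e - height_moment A e.+1.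
Proof.
rewrite /height_moment !addSn !addnS !doubleS !factS !natrM !exprS.
have := natf_fact_neq0 e; have := natf_fact_neq0 (A + e).*2.
move=> y0 x0; set x := e`!%:R in x0 *; set y := _`!%:R in y0 *.
have -> : e.*2 = (2 * e)%N by rewrite mul2n.
have -> : (A + e).*2 = (2 * (A + e))%N by rewrite mul2n.
rewrite -!natr1 !natrM !natrD.
set a := A%:R; set b := e%:R.
have a0 : 0 <= a by []. have b0 : 0 <= b by [].
field; rewrite x0 y0 -/a -/b /=.
by apply/and4P; split=> //; apply: lt0r_neq0; lra.
Qed.

Lemma cvg_height_avg_moment A e :
  (fun r => height_avg r (fun t => (1 - t ^+ 2) ^+ A * t ^+ e.*2)) @ \oo
  --> height_moment A e.
Proof.
elim: A e => [|A IH] e.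
  under eq_fun do under eq_fun do rewrite expr0 mul1r.
  rewrite (_ : height_moment 0 e = e.*2.+1%:R^-1); first exact: cvg_height_avg_pow.
  rewrite /height_moment !add0n factS natrM expr0 fact0.
  have := natf_fact_neq0 e; have := natf_fact_neq0 e.*2 => y0 x0.
  have := pnatr_eq0 R e.*2.+1; rewrite -natr1 => /negbT ?.
  by field; apply/and3P; split.
rewrite height_momentS.
have -> : (fun r => height_avg r (fun t => (1 - t ^+ 2) ^+ A.+1 * t ^+ e.*2)) =
  (fun r => height_avg r (fun t => (1 - t ^+ 2) ^+ A * t ^+ e.*2)
     - height_avg r (fun t => (1 - t ^+ 2) ^+ A * t ^+ e.+1.*2)).
  apply/funext => r; rewrite /height_avg -mulrBr -sumrB; congr (_ * _).
  by apply: eq_bigr => b _; rewrite doubleS !exprS; ring.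
exact: cvgB.
Qed.
End Heights.

(** * Averages over roots of unity *)

Section RootsOfUnity.
Variables (F : fieldType) (M : nat) (z : F).
Hypothesis zP : M.-primitive_root z.

Lemma sum_prim_root_char j k : (j < M)%N -> (k < M)%N ->
  \sum_(a < M) (z ^+ a)^-1 ^+ j * (z ^+ a) ^+ k = if j == k then M%:R else 0.
Proof.
move=> jM kM; have z0 n : z ^+ n != 0.
  apply: expf_neq0; apply/eqP => zE; have := prim_expr_order zP.
  rewrite zE expr0n gtn_eqF ?(prim_order_gt0 zP) // => /esym/eqP.
  by rewrite oner_eq0.
have -> : \sum_(a < M) (z ^+ a)^-1 ^+ j * (z ^+ a) ^+ k =
          \sum_(a < M) (z ^+ k / z ^+ j) ^+ a.
  apply: eq_bigr => a _.
  by rewrite exprVn expr_div_n -!exprM ![(a * _)%N]mulnC mulrC.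
have [<-|jk] := eqVneq j k.
  under eq_bigr do rewrite divff // expr1n.
  by rewrite sumr_const card_ord.
have w1 : z ^+ k / z ^+ j - 1 != 0.
  rewrite subr_eq0; apply: contra jk => /eqP w.
  have /eqP : z ^+ k = z ^+ j by rewrite -[RHS]mul1r -w divfK.
  by rewrite (eq_prim_root_expr zP) !modn_small // eq_sym.
apply: (mulfI w1); rewrite mulr0 -subrX1 expr_div_n -!exprM ![(_ * M)%N]mulnC.
by rewrite !exprM (prim_expr_order zP) !expr1n divr1 subrr.
Qed.

(** Since the order [M] exceeds the degree, no frequency is aliased and the
    discrete average picks exactly the terms of the trinomial expansion
    whose total frequency is zero, as the average over the whole circle
    would. *)
Lemma sum_prim_root_moment (A B T : F) n m : (n + m < M)%N ->
  \sum_(a < M) (A * z ^+ a + B * (z ^+ a)^-1 + T) ^+ n * (z ^+ a) ^+ m =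
  M%:R * \sum_(i < n.+1 | (i.*2 + m <= n)%N)
    ('C(n, i.*2 + m) * 'C(i.*2 + m, i))%:R
    * (A ^+ i * B ^+ (i + m) * T ^+ (n - (i.*2 + m))).
Proof.
move=> nM.
pose G q i := ('C(n, q) * 'C(q, i))%:R * (A ^+ i * B ^+ (q - i) * T ^+ (n - q)).
(* [q] is the joint degree of the two oscillating terms and [i] the degree
   of the first one; the frequency vanishes when q - i = i + m. *)
transitivity (\sum_(q < n.+1) \sum_(i < n.+1 | (i < q.+1)%N)
    if (q - i == i + m)%N then M%:R * G q i else 0).
  transitivity (\sum_(a < M) \sum_(q < n.+1) \sum_(i < q.+1)
      G q i * ((z ^+ a)^-1 ^+ (q - i) * (z ^+ a) ^+ (i + m))).
    apply: eq_bigr => a _.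
    rewrite addrC exprDn big_distrl; apply: eq_bigr => q _ /=.
    rewrite [A * _ + _]addrC exprDn.
    rewrite -mulr_natl mulrA mulr_sumr mulr_suml; apply: eq_bigr => i _.
    have -> : z ^+ a ^+ (i + m) = z ^+ a ^+ i * z ^+ a ^+ m by rewrite exprD.
    rewrite /G !exprMn natrM -[_ *+ 'C(q, i)]mulr_natl.
    move: (_ ^-1 ^+ _) (z ^+ a ^+ i) (z ^+ a ^+ m) (A ^+ i) (B ^+ _) (T ^+ _).
    move: ('C(n, q)%:R : F) ('C(q, i)%:R : F) => c c' w x y a1 b1 t1.
    by ring.
  rewrite exchange_big; apply: eq_bigr => q _ /=.
  rewrite exchange_big /= (big_ord_widen n.+1 (fun i => \sum_(a < M)
    G q i * ((z ^+ a)^-1 ^+ (q - i) * (z ^+ a) ^+ (i + m)))) ?ltn_ord //.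
  apply: eq_bigr => i iq; rewrite -mulr_sumr sum_prim_root_char; first last.
  - by have := ltn_ord q; lia.
  - by have := ltn_ord q; lia.
  by case: ifP; rewrite ?mulr0 // mulrC.
rewrite (exchange_big_dep predT) //= mulr_sumr big_mkcond.
rewrite [RHS]big_mkcond.
apply: eq_bigr => i _ /=; case: ifPn => [ile|inle].
  have lt : (i.*2 + m < n.+1)%N by [].
  rewrite (bigD1 (Ordinal lt)) /=; last by lia.
  rewrite big1 ?addr0.
    rewrite ifT; last by apply/eqP; lia.
    by rewrite /G; have -> : (i.*2 + m - i = i + m)%N by lia.
  move=> q /andP[iq /negbTE qE]; rewrite ifF //; apply/eqP => e.
  by move/eqP: qE; apply; apply/val_inj => /=; lia.
rewrite big1 // => q iq; rewrite ifF //; apply/eqP => e.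
by have := ltn_ord q; lia.
Qed.
End RootsOfUnity.

(** * A discrete average over the upper half sphere *)

Section Sphere.
Variable R : realType.
Local Notation C := R[i].
Local Notation R3 := (R * R * R)%type.

Definition dot (x y : R3) : R := x.1.1 * y.1.1 + x.1.2 * y.1.2 + x.2 * y.2.

(** Order 2^(r+1) is obtained from a single root of -1, which an
    algebraically closed field provides directly. *)
Definition circle_root (r : nat) : C := (2 ^ r).-root (-1).

Lemma circle_rootP r : (2 ^ r.+1).-primitive_root (circle_root r).
Proof.
have z2 : circle_root r ^+ (2 ^ r) = -1 by rewrite rootCK // expn_gt0.
have z1 : circle_root r ^+ (2 ^ r.+1) = 1.
  by rewrite expnSr exprM z2 sqrrN expr1n.
have [m mP mdvd] := prim_order_exists (expn_gt0 2 r.+1) z1.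
have /(dvdn_pfactor _ _ (isT : prime 2)) [j jr mE] := mdvd.
move: jr; rewrite leq_eqVlt => /predU1P[jE|]; first by rewrite -jE -mE.
rewrite ltnS => jr; have : (m %| 2 ^ r)%N by rewrite mE dvdn_exp2l.
by rewrite (prim_order_dvd mP) z2 -subr_eq0 -opprD oppr_eq0 (pnatr_eq0 _ 2).
Qed.

Lemma circle_root_unit r a :
  complex.Re (circle_root r ^+ a) ^+ 2 + complex.Im (circle_root r ^+ a) ^+ 2 = 1.
Proof.
have n1 : `|circle_root r| = 1.
  apply/eqP; rewrite -(@pexpr_eq1 _ _ (2 ^ r)) ?expn_gt0 //.
  by rewrite -normrX rootCK ?expn_gt0 // normrN1.
have : `|circle_root r ^+ a| = 1 by rewrite normrX n1 expr1n.
rewrite normc_def => /(congr1 (@complex.Re R)) /= /(congr1 (fun x => x ^+ 2)).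
by rewrite sqr_sqrtr ?expr1n // addr_ge0 // sqr_ge0.
Qed.

Definition node (r : nat) (t : R) (a : nat) : R3 :=
  (Num.sqrt (1 - t ^+ 2) * complex.Re (circle_root r ^+ a),
   Num.sqrt (1 - t ^+ 2) * complex.Im (circle_root r ^+ a), t).

Definition circle_avg r t (g : R3 -> R) : R :=
  (2 ^ r.+1)%:R^-1 * \sum_(a < 2 ^ r.+1) g (node r t a).

(** Only heights in [0, 1) are sampled: all the functions averaged below
    have the same mean over both hemispheres. The average is a finite sum
    with nonnegative weights, so positivity and linearity are immediate, and
    it tends to the mean over the sphere. *)
Definition sphere_avg r g : R := height_avg r (fun t => circle_avg r t g).

(** The sectoral harmonic of degree 2m, i.e. the real part of (x_1 + i
    x_2)^(2m). It comes from a null vector of C^3, so that its mean against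
    a plane wave is a radial multiple of its own value at the wave vector;
    being even, it needs only the cosine part of the wave. *)
Definition sectoral (m : nat) (x : R3) : R :=
  complex.Re ((x.1.1 +i* x.1.2)%C ^+ m.*2).

Lemma Re_sum (I : Type) (e : seq I) (P : pred I) (f : I -> C) :
  complex.Re (\sum_(i <- e | P i) f i) = \sum_(i <- e | P i) complex.Re (f i).
Proof. by apply: (big_morph (@complex.Re R)) => // -[? ?] []. Qed.

Lemma Re_realM (x : R) (w : C) : complex.Re (x%:C%C * w) = x * complex.Re w.
Proof. by case: w => a b /=; rewrite mul0r subr0. Qed.

(** The parallel is read in complex coordinates: with z the sample on the
    unit circle and s the radius, 2 (w . y) is s (ym z + yp / z) + 2 t y_3,
    to which the averaging formula over roots of unity applies. *)
Lemma circle_avg_moment r t m k y : 0 <= t <= 1 ->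
  (m.*2 + k.*2 < 2 ^ r.+1)%N ->
  circle_avg r t (fun w => sectoral m w * dot w y ^+ k.*2) =
  sectoral m y * \sum_(i < k.*2.+1 | (i + m <= k)%N)
    (('C(k.*2, (i + m).*2) * 'C((i + m).*2, i))%:R / 4 ^+ (i + m)
     * (y.1.1 ^+ 2 + y.1.2 ^+ 2) ^+ i * y.2 ^+ (k - (i + m)).*2
     * ((1 - t ^+ 2) ^+ (i + m.*2) * t ^+ (k - (i + m)).*2)).
Proof.
move=> /andP[t0 t1] mk; rewrite addnC in mk.
pose s := Num.sqrt (1 - t ^+ 2).
have s2 : s ^+ 2 = 1 - t ^+ 2 by rewrite sqr_sqrtr // subr_ge0 expr_le1.
pose z := circle_root r.
pose yp : C := (y.1.1 +i* y.1.2)%C; pose ym : C := (y.1.1 -i* y.1.2)%C.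
pose A : C := s%:C%C * ym / 2; pose B : C := s%:C%C * yp / 2.
have unit a := circle_root_unit r a.
have zV a : (z ^+ a)^-1 = (complex.Re (z ^+ a) -i* complex.Im (z ^+ a))%C.
  apply: mulr1_eq; move: (unit a); rewrite -/z.
  case: (z ^+ a) => c d /= cd; apply/eqP; rewrite eq_complex /=.
  by apply/andP; split; apply/eqP; [rewrite -cd; ring | ring].
have dotE a : (dot (node r t a) y)%:C%C =
    A * z ^+ a + B * (z ^+ a)^-1 + (t * y.2)%:C%C.
  rewrite zV /A /B /dot /= -/s -/z.
  have -> : 2 = (2 : R)%:C%C :> C by rewrite rmorph_nat.
  rewrite -fmorphV.
  case: (z ^+ a) => c d /=; apply/eqP; rewrite eq_complex /=.
  by apply/andP; split; apply/eqP; field.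
have sectoralE a : ((node r t a).1.1 +i* (node r t a).1.2)%C = s%:C%C * z ^+ a.
  rewrite /node /= -/s -/z; case: (z ^+ a) => c d /=.
  by apply/eqP; rewrite eq_complex /=; apply/andP; split; apply/eqP; ring.
have M0 : (2 ^ r.+1)%:R != 0 :> R by rewrite pnatr_eq0 expn_eq0.
rewrite /circle_avg.
transitivity ((2 ^ r.+1)%:R^-1 * complex.Re (s%:C%C ^+ m.*2 *
  \sum_(a < 2 ^ r.+1) (A * z ^+ a + B * (z ^+ a)^-1 + (t * y.2)%:C%C) ^+ k.*2
     * (z ^+ a) ^+ m.*2)).
  congr (_ * _); rewrite mulr_sumr Re_sum; apply: eq_bigr => a _.
  by rewrite -dotE mulrCA -exprMn -sectoralE -rmorphXn Re_realM mulrC.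
rewrite sum_prim_root_moment //; last exact: circle_rootP.
rewrite mulrCA; set Q := (X in _ = _ * X).
rewrite (_ : _ * \sum_(i < _ | _) _ = Q%:C%C * yp ^+ m.*2); last first.
  rewrite /Q rmorph_sum !mulr_sumr mulr_suml; apply: eq_big => [i|i ik].
    by lia.
  have twoE : 2 = (2 : R)%:C%C :> C by rewrite rmorph_nat.
  have AB : A * B = ((1 - t ^+ 2) * (y.1.1 ^+ 2 + y.1.2 ^+ 2) / 4)%:C%C.
    rewrite /A /B twoE -fmorphV -s2; apply/eqP; rewrite eq_complex /=.
    by apply/andP; split; apply/eqP; field.
  have sB : s%:C%C * B = ((1 - t ^+ 2) / 2)%:C%C * yp.
    rewrite /B twoE -fmorphV -s2; apply/eqP; rewrite eq_complex /=.
    by apply/andP; split; apply/eqP; field.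
  set c := ('C(_, _) * 'C(_, _))%N; set T := (t * y.2)%:C%C.
  have -> : s%:C%C ^+ m.*2 *
      (c%:R * (A ^+ i * B ^+ (i + m.*2) * T ^+ (k.*2 - (i.*2 + m.*2)))) =
      c%:R * (A * B) ^+ i * T ^+ (k - (i + m)).*2 * (s%:C%C * B) ^+ m.*2.
    have -> : (k.*2 - (i.*2 + m.*2) = (k - (i + m)).*2)%N by lia.
    rewrite exprD !exprMn.
    move: (c%:R : C) (A ^+ i) (B ^+ i) (B ^+ m.*2) (T ^+ _) (s%:C%C ^+ _).
    by move=> *; ring.
  rewrite AB sB exprMn mulrA /T; set U := _ / 4; set V := t * _; set W := _ / 2.
  transitivity ((c%:R * U ^+ i * V ^+ (k - (i + m)).*2 * W ^+ m.*2)%:C%C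
                * yp ^+ m.*2).
    move: U V W => U V W; rewrite !(rmorphM (real_complex R)).
    by rewrite !(rmorphXn (real_complex R)) (rmorph_nat (real_complex R)).
  congr (_%:C%C * _); rewrite /c doubleD /U /V /W !exprMn !exprVn.
  rewrite ![_ ^+ (i + _)]exprD.
  have -> : (2 : R) ^+ m.*2 = 4 ^+ m.
    by rewrite -mul2n exprM; congr (_ ^+ _); rewrite -natrX.
  have rearrange (b u v q p w a d : R) :
    b * (u * v * a) * (p * q) * (w * d) = b * (a * d) * v * q * (u * w * p).
    by ring.
  by rewrite invfM rearrange.
rewrite -(rmorph_nat (real_complex R)) !Re_realM mulKf //.
by rewrite mulrC /sectoral.
Qed.
End Sphere.

(** * Limits of the moments of the average *)

Section Moments.
Variable R : realType.
Local Notation R3 := (R * R * R)%type.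
Implicit Types (y : R3).

Lemma natr_binD n k :
  'C(n + k, k)%:R = (n + k)`!%:R / (k`!%:R * n`!%:R) :> R.
Proof.
have f0 := natf_fact_neq0 R.
by rewrite -(@bin_fact (n + k) k) ?leq_addl // addnK !natrM mulfK.
Qed.

(** After the average over heights, the coefficients coming from the
    trinomial expansion collapse to binomial coefficients up to a factor
    independent of [i]: this is why the horizontal and vertical parts of y
    recombine into powers of |y|^2, as rotation invariance predicts. *)
Lemma height_moment_bin i b m :
  ('C((i + b + m).*2, (i + m).*2) * 'C((i + m).*2, i))%:R / 4 ^+ (i + m)
    * height_moment R (i + m.*2) b =
  4 ^+ m * (i + b + m.*2)`!%:R * (i + b + m).*2`!%:R
    / ((i + b)`!%:R * (i + b + m.*2).*2.+1`!%:R) * 'C(i + b, i)%:R :> R.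
Proof.
have f0 := natf_fact_neq0 R.
have e1 : ((i + b + m).*2 = b.*2 + (i + m).*2)%N by lia.
have e2 : ((i + m).*2 = (i + m.*2) + i)%N by lia.
have e3 : (i + b = b + i)%N by lia.
rewrite natrM {1}e1 natr_binD -e1 {2}e2 natr_binD -e2.
rewrite [X in 'C(X, i)]e3 natr_binD -e3.
rewrite /height_moment (_ : i + m.*2 + b = i + b + m.*2)%N; last by lia.
rewrite (_ : 4 ^+ (i + m.*2) = 4 ^+ i * 4 ^+ m * 4 ^+ m :> R); last first.
  by rewrite -mulrA -!exprD addnn.
rewrite exprD.
have p0 n : (4 : R) ^+ n != 0 by rewrite expf_neq0 // pnatr_eq0.
move: (f0 i) (f0 b) (f0 (i + b)%N) (f0 (i + m.*2)%N) (f0 b.*2) (f0 (i + m).*2)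
  (f0 (i + b + m).*2) (f0 (i + b + m.*2)%N) (f0 (i + b + m.*2).*2.+1) (p0 i) (p0 m).
move: (i`!%:R : R) (b`!%:R : R) ((i + b)`!%:R : R) ((i + m.*2)`!%:R : R)
 (b.*2`!%:R : R) ((i + m).*2`!%:R : R)
  ((i + b + m).*2`!%:R : R) ((i + b + m.*2)`!%:R : R)
  ((i + b + m.*2).*2.+1`!%:R : R) (4 ^+ i : R) (4 ^+ m : R).
move=> x1 x2 x3 x4 x5 x6 x7 x8 x9 x10 x11 *; field.
by do ?[apply/andP; split=> //].
Qed.

(** The mean over the sphere of sectoral m w * (w . y)^(2k). *)
Definition sectoral_moment m k y : R :=
  if (m <= k)%N then
    sectoral m y * (4 ^+ m * (k + m)`!%:R * k.*2`!%:R
                / ((k - m)`!%:R * (k + m).*2.+1`!%:R)) * dot y y ^+ (k - m)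
  else 0.

Lemma cvg_sphere_moment m k y :
  (fun r => sphere_avg r (fun w => sectoral m w * dot w y ^+ k.*2)) @ \oo
  --> sectoral_moment m k y.
Proof.
pose c i : R := ('C(k.*2, (i + m).*2) * 'C((i + m).*2, i))%:R / 4 ^+ (i + m)
  * (y.1.1 ^+ 2 + y.1.2 ^+ 2) ^+ i * y.2 ^+ (k - (i + m)).*2.
have avgE : \forall r \near \oo, sectoral m y * \sum_(i < k.*2.+1 | (i + m <= k)%N)
    (c i * height_avg r
      (fun t : R => (1 - t ^+ 2) ^+ (i + m.*2) * t ^+ (k - (i + m)).*2)) =
    sphere_avg r (fun w => sectoral m w * dot w y ^+ k.*2).
  exists (m.*2 + k.*2)%N => // r /= le_r; rewrite /sphere_avg /height_avg.
  under [in RHS]eq_bigr => b _.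
    rewrite circle_avg_moment; first over.
      rewrite divr_ge0 //= ler_pdivrMr ?ltr0n // mul1r ler_nat.
      exact: ltnW.
    apply: leq_ltn_trans le_r _; apply: ltn_trans (ltn_expl r (isT : 1 < 2)%N) _.
    by rewrite ltn_exp2l.
  rewrite -mulr_sumr mulrCA; congr (_ * _).
  rewrite exchange_big mulr_sumr; apply: eq_bigr => i _ /=.
  by rewrite mulrCA mulr_sumr.
apply: cvg_trans; first exact: near_eq_cvg avgE.
have -> : sectoral_moment m k y = sectoral m y * \sum_(i < k.*2.+1 | (i + m <= k)%N)
    (c i * height_moment R (i + m.*2) (k - (i + m))).
  rewrite /sectoral_moment; case: ifPn => [mk|mk]; last first.
    by rewrite big_pred0 ?mulr0 // => i; lia.
  rewrite -!mulrA; congr (_ * _).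
  have kE : (k = (k - m) + m)%N by rewrite subnK.
  (* From here on k = l + m. *)
  move: (k - m)%N kE => l kE; rewrite /c {c avgE mk}kE.
  pose h (i : nat) : R := 4 ^+ m * (l + m.*2)`!%:R * (l + m).*2`!%:R
    / (l`!%:R * (l + m.*2).*2.+1`!%:R) * 'C(l, i)%:R *
    ((y.1.1 ^+ 2 + y.1.2 ^+ 2) ^+ i * y.2 ^+ (l - i).*2).
  transitivity (\sum_(i < l.+1) h i).
    under eq_bigr do rewrite /h -mulrA.
    rewrite -mulr_sumr -addnA addnn !mulrA; congr (_ * _).
    have -> : dot y y = y.2 ^+ 2 + (y.1.1 ^+ 2 + y.1.2 ^+ 2).
      by rewrite /dot; ring.
    (* The factor common to all terms is gone; what is left is the binomial
       expansion of |y|^2 = y_3^2 + (y_1^2 + y_2^2). *)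
    rewrite exprDn; apply: eq_bigr => i _.
    rewrite -mulr_natl -exprM mul2n; congr (_ * _).
    exact: mulrC.
  have lk : (l.+1 <= (l + m).*2.+1)%N by lia.
  rewrite (big_ord_widen _ h lk).
  apply: eq_big => [i|i il]; first lia.
  rewrite subnDr; have := height_moment_bin i (l - i) m; rewrite subnKC // /h => <-.
  by rewrite -!(mulrA (_ / _)); congr (_ * _); rewrite mulrC mulrA.
apply: cvgM; first exact: cvg_cst.
apply: (@cvgn_sum R) => i _; apply: cvgM; first exact: cvg_cst.
exact: cvg_height_avg_moment.
Qed.
End Moments.

(** * Averages of plane waves against a sectoral harmonic *)

Section SphereAverage.
Variable R : realType.
Local Notation R3 := (R * R * R)%type.
Implicit Types (y w : R3) (f g : R3 -> R).

Lemma sphere_avgE r f : sphere_avg r f = \sum_(b < r.+1)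
  \sum_(a < 2 ^ r.+1) r.+1%:R^-1 / (2 ^ r.+1)%:R * f (node r (b%:R / r.+1%:R) a).
Proof.
rewrite /sphere_avg /height_avg /circle_avg mulr_sumr; apply: eq_bigr => b _.
by rewrite mulrA mulr_sumr.
Qed.

Lemma dot_node r (b : 'I_r.+1) a :
  dot (node r (b%:R / r.+1%:R : R) a) (node r (b%:R / r.+1%:R) a) = 1.
Proof.
set t : R := _ / _; rewrite /dot /node /=.
have t01 : 0 <= 1 - t ^+ 2.
  rewrite subr_ge0 expr_le1 // ?divr_ge0 // ler_pdivrMr ?ltr0n // mul1r ler_nat.
  exact: ltnW.
have := circle_root_unit R r a; have := sqr_sqrtr t01.
move: (Num.sqrt _) (complex.Re _) (complex.Im _) => s c d s2 cd.
have -> : s * c * (s * c) + s * d * (s * d) + t * t =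
  s ^+ 2 * (c ^+ 2 + d ^+ 2) + t ^+ 2 by ring.
by rewrite cd s2 mulr1 subrK.
Qed.

Lemma ler_sphere_avg r f g : (forall w, dot w w = 1 -> f w <= g w) ->
  sphere_avg r f <= sphere_avg r g.
Proof.
move=> fg; rewrite !sphere_avgE; apply: ler_sum => b _; apply: ler_sum => a _.
by rewrite ler_wpM2l ?divr_ge0 ?invr_ge0 // fg // dot_node.
Qed.

Lemma sphere_avgZ r c f : sphere_avg r (fun w => c * f w) = c * sphere_avg r f.
Proof.
rewrite !sphere_avgE mulr_sumr; apply: eq_bigr => b _.
by rewrite mulr_sumr; apply: eq_bigr => a _; rewrite mulrCA.
Qed.

Lemma sphere_avg_sum r (I : Type) (s : seq I) (P : pred I) (f : I -> R3 -> R) :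
  sphere_avg r (fun w => \sum_(i <- s | P i) f i w) =
  \sum_(i <- s | P i) sphere_avg r (f i).
Proof.
under [RHS]eq_bigr do rewrite sphere_avgE.
rewrite sphere_avgE [RHS]exchange_big; apply: eq_bigr => b _ /=.
by rewrite [RHS]exchange_big; apply: eq_bigr => a _; rewrite mulr_sumr.
Qed.

Lemma sphere_avgD r f g :
  sphere_avg r (fun w => f w + g w) = sphere_avg r f + sphere_avg r g.
Proof.
rewrite !sphere_avgE -big_split; apply: eq_bigr => b _ /=.
by rewrite -big_split; apply: eq_bigr => a _; rewrite mulrDr.
Qed.

Lemma sphere_avg_cst r (c : R) : sphere_avg r (fun=> c) = c.
Proof.
have mean n : (0 < n)%N -> n%:R^-1 * \sum_(i < n) c = c.
  move=> n0; rewrite sumr_const card_ord -[c *+ n]mulr_natl mulKf //.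
  by rewrite pnatr_eq0 -lt0n.
rewrite /sphere_avg /height_avg /circle_avg mean ?expn_gt0 //.
exact: mean.
Qed.

Lemma cvg_sphere_avg r (f : nat -> R3 -> R) g :
  (forall w, f^~ w @ \oo --> g w) ->
  (fun n => sphere_avg r (f n)) @ \oo --> sphere_avg r g.
Proof.
move=> fg; under eq_fun do rewrite sphere_avgE.
rewrite sphere_avgE; apply: (@cvgn_sum R) => b _; apply: (@cvgn_sum R) => a _.
by apply: cvgM; [exact: cvg_cst|exact: fg].
Qed.

Lemma sqr_normc_exp (z : R[i]) n :
  complex.Re (z ^+ n) ^+ 2 + complex.Im (z ^+ n) ^+ 2 =
  (complex.Re z ^+ 2 + complex.Im z ^+ 2) ^+ n.
Proof.
elim: n => [|n IH]; first by rewrite !expr0 /= expr0n expr1n addr0.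
rewrite [z ^+ _]exprS [RHS]exprS -IH; case: z {IH} (z ^+ n) => a b [c d] /=; ring.
Qed.

(** The modulus of a power is the power of the modulus. This growth rate,
    equality being reached on the first axis, is what separates the points
    at the end. *)
Lemma normr_sectoral_le m y : `|sectoral m y| <= (y.1.1 ^+ 2 + y.1.2 ^+ 2) ^+ m.
Proof.
rewrite -(@ler_pXn2r _ 2) ?nnegrE ?exprn_ge0 ?addr_ge0 ?sqr_ge0 //.
rewrite real_normK ?num_real // -exprM muln2 /sectoral.
by rewrite -(sqr_normc_exp (y.1.1 +i* y.1.2)%C) lerDl sqr_ge0.
Qed.

Lemma normr_sectoral_le1 m w : dot w w = 1 -> `|sectoral m w| <= 1.
Proof.
move=> w1; apply: le_trans (normr_sectoral_le m w) _.
rewrite exprn_ile1 ?addr_ge0 ?sqr_ge0 // -w1 /dot -!expr2 lerDl.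
exact: sqr_ge0.
Qed.

Lemma normr_dot_le w y : dot w w = 1 ->
  `|dot w y| <= `|y.1.1| + `|y.1.2| + `|y.2|.
Proof.
rewrite /dot -!expr2 => w1.
have le1 (x : R) : x ^+ 2 <= 1 -> `|x| <= 1.
  by move=> x1; rewrite -(@ler_pXn2r _ 2) ?nnegrE // expr1n real_normK ?num_real.
have a0 := sqr_ge0 w.1.1; have b0 := sqr_ge0 w.1.2; have c0 := sqr_ge0 w.2.
by apply: le_trans (ler_normD _ _) _; apply: lerD;
  [apply: le_trans (ler_normD _ _) _; apply: lerD|];
  rewrite normrM ler_piMl // le1 //; lra.
Qed.

(** The cosine is expanded in its Taylor series, whose terms have explicit
    limits; on the sphere |w . y| is bounded by a constant q, so the terms
    are dominated by those of the exponential series at q^2. *)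
Lemma cvg_sphere_avg_cos_series m y :
  (fun r => sphere_avg r (fun w => sectoral m w * cos (dot w y))) @ \oo -->
  limn (series (fun k => (-1) ^+ k / k.*2`!%:R * sectoral_moment m k y)).
Proof.
pose q := `|y.1.1| + `|y.1.2| + `|y.2|.
have q0 : 0 <= q by rewrite !addr_ge0.
apply: (@tannery R (fun r k => (-1) ^+ k / k.*2`!%:R *
    sphere_avg r (fun w => sectoral m w * dot w y ^+ k.*2)) _ (exp_coeff (q ^+ 2))).
- by move=> k; apply: cvgM; [exact: cvg_cst|exact: cvg_sphere_moment].
- move=> r k; rewrite normrM normrM normrX normrN1 expr1n mul1r.
  rewrite normfV (ger0_norm (ler0n _ _)) /exp_coeff /= mulrC.
  have avg_le : `|sphere_avg r (fun w => sectoral m w * dot w y ^+ k.*2)| <=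
                q ^+ k.*2.
    have bnd w : dot w w = 1 -> `|sectoral m w * dot w y ^+ k.*2| <= q ^+ k.*2.
      move=> w1; rewrite normrM -[leRHS]mul1r ler_pM ?normr_sectoral_le1 //.
      by rewrite normrX lerXn2r ?nnegrE // normr_dot_le.
    rewrite ler_norml -(sphere_avg_cst r (- _)) -[X in _ && (_ <= X)](sphere_avg_cst r).
    by apply/andP; split; apply: ler_sphere_avg => w /bnd; rewrite ler_norml => /andP[].
  apply: ler_pM => //.
    by rewrite -exprM mul2n.
  by rewrite lef_pV2 ?posrE ?ltr0n ?fact_gt0 // ler_nat leq_fact // -addnn leq_addl.
- exact: is_cvg_series_exp_coeff.
- move=> r; have : (fun n => sphere_avg r
       (fun w => sectoral m w * series (cos_coeff' (dot w y)) n))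
     @ \oo --> sphere_avg r (fun w => sectoral m w * cos (dot w y)).
    apply: cvg_sphere_avg => w; apply: cvgM; first exact: cvg_cst.
    exact: cvg_cos_coeff'.
  apply: cvg_trans; apply: near_eq_cvg; apply: nearW => n.
  rewrite /series /=.
  under [RHS]eq_bigr do rewrite -sphere_avgZ.
  rewrite -sphere_avg_sum; congr (sphere_avg r _); apply/funext => w.
  rewrite mulr_sumr; apply: eq_bigr => k _.
  by rewrite /cos_coeff' -exprnP; ring.
Qed.
End SphereAverage.

(** * The radial profile of the averages *)

Section Profile.
Variable R : realType.
Local Notation R3 := (R * R * R)%type.
Implicit Types (y w : R3) (x : R).

(** The normalised ratio between the coefficients of the radial profile in
    degree 2m and those of exp (-x). It is 1 at k = 0 and decays in [m] for
    k > 0, so that the profile flattens to 1 as the degree grows. *)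
Definition damping (m k : nat) : R :=
  (k + m.*2)`!%:R * (m.*2).*2.+1`!%:R / (m.*2`!%:R * (k + m.*2).*2.+1`!%:R).

Definition profile_coeff (m : nat) (x : R) (k : nat) : R :=
  (-1) ^+ k * x ^+ k / k`!%:R * damping m k.

(** Up to normalisation, the function x^(-m) j_(2m) (sqrt x), with j_(2m)
    the spherical Bessel function of order 2m: it is entire in x and equals
    1 at 0. For m = 0 it is sinc (sqrt x). *)
Definition profile m x : R := limn (series (profile_coeff m x)).

Definition amplitude m : R :=
  (-1) ^+ m * 4 ^+ m * m.*2`!%:R / (m.*2).*2.+1`!%:R.

Lemma damping0 m : damping m 0 = 1.
Proof.
by rewrite /damping add0n divff // mulf_neq0 // natf_fact_neq0.
Qed.

Lemma damping_ge0 m k : 0 <= damping m k.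
Proof. by rewrite /damping divr_ge0 // mulr_ge0. Qed.

Lemma dampingS m k : damping m k.+1 <= damping m k * m.+1%:R^-1.
Proof.
have -> : damping m k.+1 = damping m k * (2 * (k + m.*2).*2.+3%:R)^-1.
  have f0 := natf_fact_neq0 R.
  rewrite /damping addSn doubleS !factS !natrM.
  have := (f0 m.*2); have := f0 (k + m.*2).*2.+1; rewrite factS natrM.
  rewrite mulf_eq0 negb_or => /andP[].
  set p := (k + m.*2)%N; rewrite -![in p.*2]addnn -![_.+1%:R]natr1 natrD.
  have := ler0n R p.
  move: (p%:R : R) (p`!%:R : R) ((p + p)`!%:R : R) (m.*2`!%:R : R) => u v a b u0 ? a0 b0.
  field.
  by do ?[apply/andP; split=> //]; apply: lt0r_neq0; lra.
rewrite ler_wpM2l ?damping_ge0 // lef_pV2 ?posrE ?mulr_gt0 ?ltr0n //.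
by rewrite -natrM ler_nat; lia.
Qed.

Lemma damping_le1 m k : damping m k <= 1.
Proof.
elim: k => [|k IH]; first by rewrite damping0.
apply: le_trans (dampingS m k) _; rewrite -[leRHS]mulr1 ler_pM ?damping_ge0 //.
by rewrite invf_le1 ?ltr0n // ler1n.
Qed.

Lemma cvg_damping k : damping ^~ k @ \oo --> ((k == 0)%:R : R).
Proof.
case: k => [|k] /=.
  by under eq_fun do rewrite damping0; exact: cvg_cst.
apply: (@squeeze_cvgr _ _ _ _ (fun=> 0) (fun m => m.+1%:R^-1)).
- apply: nearW => m; rewrite damping_ge0 /=.
  apply: le_trans (dampingS m k) _.
  by rewrite ler_piMl ?invr_ge0 // damping_le1.
- exact: cvg_cst.
- exact: cvg_harmonic.
Qed.

Lemma normr_profile_coeff m x k : `|profile_coeff m x k| <= exp_coeff `|x| k.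
Proof.
rewrite /profile_coeff /exp_coeff /= normrM (ger0_norm (damping_ge0 _ _)).
rewrite !normrM normrX normrN1 expr1n mul1r normrX normfV (ger0_norm (ler0n _ _)).
by rewrite ler_piMr ?damping_le1 // divr_ge0 // exprn_ge0.
Qed.

Lemma cvg_profile m x : series (profile_coeff m x) @ \oo --> profile m x.
Proof.
apply: normed_cvg; apply: series_le_cvg (is_cvg_series_exp_coeff `|x|) => //= n.
  by rewrite exp_coeff_ge0.
exact: normr_profile_coeff.
Qed.

(** A high degree test function sees all points with the same weight,
    whatever their distance to the origin. *)
Lemma cvg_profile_1 x : profile ^~ x @ \oo --> (1 : R).
Proof.
have -> : 1 = limn (series (fun k => (-1) ^+ k * x ^+ k / k`!%:R * (k == 0)%:R)).
  apply/esym/cvg_lim => //; apply: cvg_near_cst; exists 1%N => // n /= n1.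
  apply/eqP; rewrite /series /= -(prednK n1) big_nat_recl //= big1.
    by rewrite !expr0 fact0 !mulr1 divr1 addr0.
  by move=> i _; rewrite mulr0.
apply: (tannery _ (normr_profile_coeff ^~ x) (is_cvg_series_exp_coeff _)).
  by move=> k; apply: cvgM; [exact: cvg_cst|exact: cvg_damping].
by move=> m; exact: cvg_profile.
Qed.

Lemma amplitude_neq0 m : amplitude m != 0.
Proof.
by rewrite /amplitude !mulf_neq0 ?invr_eq0 ?natf_fact_neq0 ?expf_neq0.
Qed.

(** A case of the Funk-Hecke formula. For m = 0 it says that the mean of a
    plane wave over the unit sphere is a sinc. *)
Lemma cvg_sphere_avg_sectoral_cos m y :
  (fun r => sphere_avg r (fun w => sectoral m w * cos (dot w y))) @ \oo -->
  sectoral m y * amplitude m * profile m (dot y y).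
Proof.
have <- : limn (series (fun k => (-1) ^+ k / k.*2`!%:R * sectoral_moment m k y)) =
  sectoral m y * amplitude m * profile m (dot y y); last exact: cvg_sphere_avg_cos_series.
apply/cvg_lim => //.
set u := (fun k => _ * _); rewrite -(cvg_shiftn m).
have -> : (fun n => series u (n + m)) =
    (fun n => sectoral m y * amplitude m * series (profile_coeff m (dot y y)) n).
  apply/funext => n; rewrite series_addn [series u m]big1_seq ?add0r; last first.
    move=> k /andP[_]; rewrite mem_index_iota => /andP[_ km].
    by rewrite /u /sectoral_moment leqNgt km mulr0.
  rewrite -{1}[m]add0n big_addn addnK [RHS]mulr_sumr.
  apply: eq_bigr => k _; rewrite /u /sectoral_moment leq_addl addnK.
  rewrite /profile_coeff /amplitude /damping.
  have := natf_fact_neq0 R (k + m).*2; have := natf_fact_neq0 R (m.*2).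
  have := natf_fact_neq0 R (m.*2).*2.+1; have := natf_fact_neq0 R k.
  have := natf_fact_neq0 R (k + m.*2).*2.+1.
  rewrite -addnA addnn exprD.
  move: (_ `!%:R : R) => a; move: (_ `!%:R : R) => b.
  move: (m.*2.*2.+1`!%:R : R) (m.*2`!%:R : R) ((k + m).*2`!%:R : R) => c d e.
  move: ((k + m.*2)`!%:R : R) (sectoral m y) (dot y y ^+ k) => f h p.
  move: (4 ^+ m : R) ((-1) ^+ m : R) ((-1) ^+ k : R) => q s t *.
  by field; do ?[apply/andP; split=> //].
by apply: cvgM; [exact: cvg_cst|exact: cvg_profile].
Qed.

Lemma sectoral0 y : sectoral 0 y = 1. Proof. by []. Qed.

Lemma amplitude0 : amplitude 0 = 1.
Proof. by rewrite /amplitude !expr0 !mul1r invr1. Qed.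

Lemma sinE x : sin x = x * profile 0 (x ^+ 2).
Proof.
apply: (cvg_unique _ (@cvg_sin_coeff' R x)) => //.
have : (fun n => x * series (profile_coeff 0 (x ^+ 2)) n) @ \oo -->
       x * profile 0 (x ^+ 2).
  by apply: cvgM; [exact: cvg_cst|exact: cvg_profile].
apply: cvg_trans; apply: near_eq_cvg; apply: nearW => n.
rewrite /series /= mulr_sumr; apply: eq_bigr => k _.
rewrite /sin_coeff' /profile_coeff /damping -exprnP /= addn0.
have -> : (0.*2.*2.+1)`!%:R = 1 :> R by [].
have := natf_fact_neq0 R k; have := natf_fact_neq0 R k.*2.+1.
rewrite [x ^+ k.*2.+1]exprS (_ : x ^+ k.*2 = (x ^+ 2) ^+ k); last first.
  by rewrite -mul2n exprM.
move: (k`!%:R : R) (k.*2.+1`!%:R : R) ((-1) ^+ k : R) (_ ^+ _) => a b s t ? ?.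
by field; apply/andP.
Qed.

Lemma profile00 : profile 0 0 = 1.
Proof.
apply/cvg_lim => //; apply: cvg_near_cst; exists 1%N => // n /= n1.
apply/eqP; rewrite /series /= -(prednK n1) big_nat_recl //= big1.
  by rewrite /profile_coeff damping0 !expr0 fact0 !mulr1 divr1 addr0.
by move=> i _; rewrite /profile_coeff expr0n /= !(mulr0, mul0r).
Qed.
End Profile.

(** * Strict positive definiteness of the sinc kernel *)

Section PositiveDefinite.
Variable R : realType.
Local Notation R3 := (R * R * R)%type.
Implicit Types (x y w u p : R3).

Lemma dotBr w x y : dot w (x - y) = dot w x - dot w y.
Proof. by rewrite /dot /=; ring. Qed.

Lemma dot_sub x y : dot (x - y) (x - y) = dot x x - 2 * dot x y + dot y y.
Proof. by rewrite /dot /=; ring. Qed.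

Lemma dot_ge0 x : 0 <= dot x x.
Proof. by rewrite /dot -!expr2 !addr_ge0 ?sqr_ge0. Qed.

Lemma dot_eq0 x : dot x x = 0 -> x = 0.
Proof.
case: x => [[a b] c]; rewrite /dot /= -!expr2 => abc.
have := (sqr_ge0 a, sqr_ge0 b, sqr_ge0 c) => -[[a0 b0] c0].
have z (t : R) : t ^+ 2 = 0 -> t = 0 by move/eqP; rewrite sqrf_eq0 => /eqP.
by congr (_, _, _); apply: z; lra.
Qed.

Definition sinc_form N (Y : 'I_N -> R3) (a : 'I_N -> R) : R :=
  \sum_j \sum_k a j * a k * profile 0 (dot (Y j - Y k) (Y j - Y k)).

(** The sinc form is a limit of averages of |sum_j a_j exp (i w . Y_j)|^2,
    here split into its cosine and sine parts. *)
Lemma cvg_sinc_form N (Y : 'I_N -> R3) (a : 'I_N -> R) :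
  (fun r => sphere_avg r (fun w => (\sum_j a j * cos (dot w (Y j))) ^+ 2
                                 + (\sum_j a j * sin (dot w (Y j))) ^+ 2))
    @ \oo --> sinc_form Y a.
Proof.
have -> : (fun w => (\sum_j a j * cos (dot w (Y j))) ^+ 2
                  + (\sum_j a j * sin (dot w (Y j))) ^+ 2) =
    (fun w => \sum_j \sum_k
                (a j * a k) * (sectoral 0 w * cos (dot w (Y j - Y k)))).
  apply/funext => w; rewrite !expr2 !mulr_suml -big_split.
  apply: eq_bigr => j _ /=; rewrite !mulr_sumr -big_split.
  by apply: eq_bigr => k _; rewrite /= sectoral0 dotBr cosB; ring.
under eq_fun do rewrite sphere_avg_sum.
apply: (@cvgn_sum R) => j _; under eq_fun do rewrite sphere_avg_sum.
apply: (@cvgn_sum R) => k _; under eq_fun do rewrite sphere_avgZ.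
apply: cvgM; first exact: cvg_cst.
have := @cvg_sphere_avg_sectoral_cos R 0 (Y j - Y k).
by rewrite sectoral0 amplitude0 !mul1r.
Qed.

Lemma sinc_form_ge0 N (Y : 'I_N -> R3) (a : 'I_N -> R) : 0 <= sinc_form Y a.
Proof.
apply: (cvgr_to_ge (@cvg_sinc_form N Y a)); apply: nearW => r.
rewrite -(sphere_avg_cst r 0); apply: ler_sphere_avg => w _.
by rewrite addr_ge0 ?sqr_ge0.
Qed.

(** If the form vanishes, the function sum_j a_j exp (i w . Y_j) has mean
    square zero on the sphere, so it is orthogonal to every sectoral
    harmonic; the orthogonality relation is computed by the Funk-Hecke
    formula. *)
Lemma sinc_form0_orthogonal N (Y : 'I_N -> R3) (a : 'I_N -> R) m :
  sinc_form Y a = 0 ->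
  \sum_j a j * (sectoral m (Y j) * profile m (dot (Y j) (Y j))) = 0.
Proof.
move=> Ya0; set s := \sum_j _.
pose f w := \sum_j a j * cos (dot w (Y j)).
pose g w := \sum_j a j * sin (dot w (Y j)).
pose l := amplitude R m * s.
have fl : (fun r => sphere_avg r (fun w => sectoral m w * f w)) @ \oo --> l.
  have -> : l = \sum_j a j *
      (sectoral m (Y j) * amplitude R m * profile m (dot (Y j) (Y j))).
    by rewrite /l /s mulr_sumr; apply: eq_bigr => j _; ring.
  have -> : (fun w => sectoral m w * f w) =
      (fun w => \sum_j a j * (sectoral m w * cos (dot w (Y j)))).
    by apply/funext => w; rewrite /f mulr_sumr; apply: eq_bigr => j _; ring.
  under eq_fun do rewrite sphere_avg_sum.
  apply: (@cvgn_sum R) => j _; under eq_fun do rewrite sphere_avgZ.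
  by apply: cvgM; [exact: cvg_cst|exact: cvg_sphere_avg_sectoral_cos].
(* With l the limit of the averages of h f and |h| <= 1 on the sphere,
   averaging 2 l h f <= f^2 + l^2 gives 2 l^2 <= l^2, hence l = 0. *)
have le2 r : 2 * l * sphere_avg r (fun w => sectoral m w * f w) <=
    sphere_avg r (fun w => f w ^+ 2 + g w ^+ 2) + l ^+ 2.
  rewrite -sphere_avgZ -[X in _ + X](sphere_avg_cst r) -sphere_avgD.
  apply: ler_sphere_avg => w /(normr_sectoral_le1 m) h1.
  have h2 : sectoral m w ^+ 2 <= 1.
    by rewrite -real_normK ?num_real // expr_le1.
  have := sqr_ge0 (f w - l * sectoral m w); have := sqr_ge0 (g w).
  have := ler_wpM2l (sqr_ge0 l) h2; rewrite mulr1 -exprMn.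
  move: (f w) (g w) (sectoral m w) => F G H.
  nra.
have : 2 * l * l <= 0 + l ^+ 2.
  have c1 : (fun r => 2 * l * sphere_avg r (fun w => sectoral m w * f w)) @ \oo
      --> 2 * l * l.
    by apply: cvgM; [exact: cvg_cst|exact: fl].
  have c2 : (fun r => sphere_avg r (fun w => f w ^+ 2 + g w ^+ 2) + l ^+ 2)
      @ \oo --> 0 + l ^+ 2.
    have sq := @cvg_sinc_form N Y a; rewrite Ya0 in sq.
    by apply: cvgD; [exact: sq|exact: cvg_cst].
  by apply: (ler_cvg_to c1 c2); exact: nearW.
rewrite add0r => l0; have : l ^+ 2 <= 0 by move: l0; rewrite -mulrA -expr2; lra.
rewrite le_eqVlt ltNge sqr_ge0 orbF sqrf_eq0 mulf_eq0.
by rewrite (negbTE (amplitude_neq0 R m)) => /eqP.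
Qed.

(** The reflection exchanging [u] and [- u]; for u = 0 it is the identity,
    since then the quotient is 0. *)
Definition mirror u x : R3 :=
  let c := 2 * dot u x / dot u u in
  (x.1.1 - c * u.1.1, x.1.2 - c * u.1.2, x.2 - c * u.2).

Lemma dot_mirror u x y : dot (mirror u x) (mirror u y) = dot x y.
Proof.
rewrite /mirror; have [u0|u0] := eqVneq (dot u u) 0.
  by rewrite u0 invr0 !mulr0 /dot /= !mul0r !subr0.
have -> : dot (mirror u x) (mirror u y) =
  dot x y - 2 * dot u y / dot u u * dot u x - 2 * dot u x / dot u u * dot u y
  + 2 * dot u x / dot u u * (2 * dot u y / dot u u) * dot u u.
  rewrite {1}/dot /mirror /=; move: (2 * dot u x / _) (2 * dot u y / _).
  by move=> c d; rewrite /dot; ring.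
by field.
Qed.

(** The mirror direction is p - |p| e_1 (Householder). *)
Lemma mirror_to_axis p : exists u, mirror u p = (Num.sqrt (dot p p), 0, 0).
Proof.
set r := Num.sqrt _.
have r2 : r ^+ 2 = dot p p by rewrite sqr_sqrtr // dot_ge0.
pose u : R3 := (p.1.1 - r, p.1.2, p.2).
have uu : dot u u = 2 * dot u p.
  by move: r2; rewrite /dot /u /= => r2; ring: r2.
exists u; rewrite /mirror -uu; have [u0|u0] := eqVneq (dot u u) 0.
  have /dot_eq0 := u0; rewrite /u => -[/eqP]; rewrite subr_eq0 => /eqP p1 p2 p3.
  by rewrite u0 mul0r !mul0r !subr0 p1 p2 p3.
by rewrite divff // !mul1r /u /= !subrr opprB addrC subrK.
Qed.

(** Among the points carrying a nonzero coefficient let Y_p have maximal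
    norm, and translate by Y_p: the parallelogram identity makes 2 Y_p the
    unique farthest point from the origin. A reflection puts it on the first
    axis, where the sectoral harmonics are largest. The orthogonality
    relation of degree 2m, divided by r^(2m) with r = 2 |Y_p|, then tends to
    a_p = 0 as m grows. *)
Lemma sinc_form_eq0 N (Y : 'I_N -> R3) (a : 'I_N -> R) :
  injective Y -> sinc_form Y a = 0 -> forall j, a j = 0.
Proof.
move=> Yinj Ya0 j0; apply/eqP; apply: contraT => aj0.
have [p ap pmax] := @arg_maxP _ _ _ j0 (fun j => a j != 0)
  (fun j => dot (Y j) (Y j)) aj0.
have [u] := mirror_to_axis (Y p + Y p).
set r := Num.sqrt _ => up.
pose y j := mirror u (Y j + Y p).
have r2 : r ^+ 2 = 4 * dot (Y p) (Y p).
  by rewrite sqr_sqrtr ?dot_ge0 // /dot /=; ring.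
have ya0 : sinc_form y a = 0.
  rewrite -Ya0; apply: eq_bigr => j _; apply: eq_bigr => k _.
  congr (_ * profile 0 _); rewrite dot_sub !dot_mirror -dot_sub.
  by rewrite /dot /=; ring.
have yp : y p = (r, 0, 0) by [].
have sep j : j != p -> dot (Y j - Y p) (Y j - Y p) > 0.
  move=> jp; rewrite lt_neqAle dot_ge0 andbT eq_sym.
  apply: contra jp => /eqP/dot_eq0/eqP; rewrite subr_eq0 => /eqP/Yinj.
  by move=> ->.
have closer j : j != p -> a j != 0 -> (y j).1.1 ^+ 2 + (y j).1.2 ^+ 2 < r ^+ 2.
  move=> jp aj; have := sep _ jp; have := pmax j aj.
  have : dot (y j) (y j) = 2 * dot (Y j) (Y j) + 2 * dot (Y p) (Y p)
                         - dot (Y j - Y p) (Y j - Y p).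
    by rewrite dot_mirror /dot /=; ring.
  rewrite r2 {1}/dot -!expr2; have := sqr_ge0 (y j).2.
  by rewrite /=; lra.
have orth m := sinc_form0_orthogonal m ya0.
(* If r = 0, every point carrying a nonzero coefficient is at the origin, so
   there is only one; the relation of degree 0 already gives a_p = 0. *)
have [r0|r0] := eqVneq (r ^+ 2) 0.
  have := orth 0; rewrite (bigD1 p) //= big1.
    rewrite addr0 yp sectoral0 mul1r.
    have -> : dot (r, 0, 0) (r, 0, 0) = 0 :> R.
      by rewrite /dot /= -expr2 r0 !mulr0 !addr0.
    by rewrite profile00 mulr1 => /eqP; rewrite (negbTE ap).
  move=> j jp; have [->|/(closer j jp)] := eqVneq (a j) 0; first by rewrite mul0r.
  by rewrite r0 ltNge addr_ge0 ?sqr_ge0.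
have r20 : 0 < r ^+ 2 by rewrite lt_neqAle eq_sym r0 sqr_ge0.
suff : (fun m => \sum_j a j * (sectoral m (y j) / (r ^+ 2) ^+ m
                               * profile m (dot (y j) (y j)))) @ \oo --> a p.
  under eq_fun => m.
    under eq_bigr do rewrite [_ / _]mulrC -mulrA mulrCA.
    rewrite -mulr_sumr orth mulr0; over.
  move=> /(cvg_unique _ (cvg_cst _)) a0.
  by rewrite -a0 ?eqxx in ap.
have -> : a p = \sum_j (if j == p then a j else 0).
  by rewrite -big_mkcond big_pred1_eq.
apply: (@cvgn_sum R) => j _; have [->|jp] := eqVneq j p.
  rewrite -[X in _ --> X]mulr1; apply: cvgM; first exact: cvg_cst.
  rewrite yp (_ : (fun m => _) = (fun m => profile m (dot (r, 0, 0) (r, 0, 0)))).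
    exact: cvg_profile_1.
  apply/funext => m; rewrite -[RHS]mul1r; congr (_ * _).
  have -> : sectoral m (r, 0, 0) = (r ^+ 2) ^+ m.
    rewrite /sectoral /= -[(r +i* 0)%C]/(r%:C)%C -rmorphXn /=.
    by rewrite -exprM mul2n.
  by rewrite divff // expf_neq0.
have [->|aj] := eqVneq (a j) 0.
  by under eq_fun do rewrite mul0r; exact: cvg_cst.
rewrite -[X in _ --> X](mulr0 (a j)); apply: cvgM; first exact: cvg_cst.
rewrite -[X in _ --> X](mul0r 1); apply: cvgM; last exact: cvg_profile_1.
pose q := ((y j).1.1 ^+ 2 + (y j).1.2 ^+ 2) / r ^+ 2.
have q0 : 0 <= q by rewrite divr_ge0 ?addr_ge0 ?sqr_ge0.
have q1 : q < 1 by rewrite ltr_pdivrMr // mul1r closer.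
have qm : (fun m => q ^+ m) @ \oo --> (0 : R) by apply: cvg_expr; rewrite ger0_norm.
apply: norm_cvg0; apply: (@squeeze_cvgr _ _ _ _ (fun=> 0) (fun m => q ^+ m)).
- apply: nearW => m; rewrite normr_ge0 /= normrM normfV normrX.
  rewrite (ger0_norm (sqr_ge0 r)) /q expr_div_n ler_pM2r; last first.
    by rewrite invr_gt0; exact: exprn_gt0.
  exact: normr_sectoral_le.
- exact: cvg_cst.
- exact: qm.
Qed.
End PositiveDefinite.

(** * The matrix on the real axis *)

Section GammaOnRealAxis.
Variables (R : realType) (N : nat) (alpha : 'I_N -> R) (Y : 'I_N -> R * R * R).
Hypothesis Yinj : injective Y.
Local Notation R3 := (R * R * R)%type.

Lemma edistE (x y : R3) : Defs.edist x y = Num.sqrt (dot (x - y) (x - y)).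
Proof. by rewrite /Defs.edist /dot -!expr2. Qed.

Lemma edistC (x y : R3) : Defs.edist x y = Defs.edist y x.
Proof. by rewrite !edistE; congr Num.sqrt; rewrite /dot /=; ring. Qed.

Lemma Gamma_sym z j k : Gamma alpha Y z j k = Gamma alpha Y z k j.
Proof.
rewrite !mxE eq_sym; case: eqVneq => [->//|_].
by rewrite /green_off eq_sym /green edistC.
Qed.

(** Scaling by [z] turns sin (z d) / (z d), with d the distance of two
    points, into the sinc of the distance of their images. *)
Definition dilate (z : R) (x : R3) : R3 := (z * x.1.1, z * x.1.2, z * x.2).

(** On the real axis the diagonal term - i z / (4 pi) is the limit at
    distance 0 of the off-diagonal term - i sin (z d) / (4 pi d): the
    imaginary part is one and the same kernel at all index pairs. *)
Lemma Im_Gamma (z : R) j k :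
  complex.Im (Gamma alpha Y z%:C%C j k) = - (z / (4 * pi)) *
    profile 0 (dot (dilate z (Y j) - dilate z (Y k)) (dilate z (Y j) - dilate z (Y k))).
Proof.
have pi0 : pi != 0 :> R by rewrite gt_eqF // pi_gt0.
have ImV (c : R[i]) (d : R) : complex.Im (c / d%:C%C) = complex.Im c / d.
  by rewrite -fmorphV; case: c => a b /=; rewrite mulr0 add0r.
have ImB (a b : R[i]) : complex.Im (a - b) = complex.Im a - complex.Im b.
  by case: a b => ? ? [].
rewrite mxE /green_off; have [<-|jk] := eqVneq j k.
  rewrite eqxx mulr1n subr0 [dot _ _](_ : _ = 0); last by rewrite /dot /=; ring.
  rewrite profile00 mulr1 ImB ImV /=; ring.
rewrite (inj_eq Yinj) eq_sym (negbTE jk) mulr0n sub0r /green.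
set d := Defs.edist _ _.
have d2 : d ^+ 2 = dot (Y j - Y k) (Y j - Y k).
  by rewrite /d edistC edistE sqr_sqrtr // dot_ge0.
have d0 : d != 0.
  apply: contra jk => /eqP dE; move: d2; rewrite dE expr0n /=.
  by move=> /esym/dot_eq0/eqP; rewrite subr_eq0 (inj_eq Yinj).
have -> : dot (dilate z (Y j) - dilate z (Y k)) (dilate z (Y j) - dilate z (Y k))
   = (z * d) ^+ 2.
  by rewrite exprMn d2 /dot /dilate /=; ring.
rewrite -[- _]sub0r ImB ImV /cexp /=.
rewrite !(mul0r, mulr0, subr0, add0r, addr0, mul1r, subrr, oppr0) expR0 mul1r sinE.
by move: (pi : R) pi0 => c c0; field; rewrite d0 c0.
Qed.

(** If v Gamma = 0, the imaginary part of v Gamma v^* vanishes. The real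
    symmetric part of Gamma contributes nothing to it, so the sinc forms of
    the real and imaginary parts of v add up to 0, and both vanish. *)
Lemma Gamma_real_unitmx (z : R) : z != 0 -> Gamma alpha Y z%:C%C \in unitmx.
Proof.
move=> z0; rewrite unitmxE unitfE; apply/negP => /det0P[v v0 vG].
set G := Gamma _ _ _ in vG.
pose x j := complex.Re (v 0 j); pose w j := complex.Im (v 0 j).
pose A j k := complex.Re (G j k); pose B j k := complex.Im (G j k).
pose P j := dilate z (Y j).
have eqC k : \sum_j v 0 j * G j k = 0.
  by have /matrixP/(_ 0 k) := vG; rewrite !mxE.
have Re_eq k : \sum_j (x j * A j k - w j * B j k) = 0.
  rewrite -[RHS](congr1 (@complex.Re R) (eqC k)) Re_sum.
  by apply: eq_bigr => j _; rewrite /x /w /A /B; case: (v 0 j) (G j k) => ? ? [].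
have Im_eq k : \sum_j (x j * B j k + w j * A j k) = 0.
  transitivity (complex.Im (\sum_j v 0 j * G j k)); last by rewrite eqC.
  rewrite (big_morph (@complex.Im R) (id1 := 0) (op1 := +%R)) //; last first.
    by case=> ? ? [].
  by apply: eq_bigr => j _; rewrite /x /w /A /B; case: (v 0 j) (G j k) => ? ? [].
have forms : sinc_form P x + sinc_form P w = 0.
  have : \sum_k (x k * \sum_j (x j * B j k + w j * A j k)
               - w k * \sum_j (x j * A j k - w j * B j k)) = 0.
    by apply: big1 => k _; rewrite Re_eq Im_eq !mulr0 subrr.
  have -> : \sum_k (x k * \sum_j (x j * B j k + w j * A j k)
               - w k * \sum_j (x j * A j k - w j * B j k)) =
    \sum_k \sum_j (x j * x k * B j k + w j * w k * B j k) +
    (\sum_k \sum_j w j * x k * A j k - \sum_k \sum_j x j * w k * A j k).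
    rewrite -sumrB -big_split; apply: eq_bigr => k _ /=.
    rewrite !mulr_sumr -!sumrB -big_split; apply: eq_bigr => j _ /=; ring.
  (* The contribution of the real part cancels by symmetry. *)
  have -> : \sum_k \sum_j w j * x k * A j k = \sum_k \sum_j x j * w k * A j k.
    rewrite exchange_big; apply: eq_bigr => k _; apply: eq_bigr => j _.
    by rewrite /A /G Gamma_sym; ring.
  rewrite subrr addr0.
  have -> : \sum_k \sum_j (x j * x k * B j k + w j * w k * B j k) =
     - (z / (4 * pi)) * (sinc_form P x + sinc_form P w).
    rewrite exchange_big -big_split mulr_sumr; apply: eq_bigr => j _ /=.
    rewrite -big_split mulr_sumr; apply: eq_bigr => k _ /=.
    by rewrite /B Im_Gamma; ring.
  move=> /eqP; rewrite mulf_eq0 oppr_eq0 mulf_eq0 (negbTE z0) invr_eq0 /=.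
  by rewrite mulf_eq0 pnatr_eq0 /= gt_eqF ?pi_gt0 //= => /eqP.
have Pinj : injective P.
  move=> j k [e1 e2 e3]; apply: Yinj; apply/eqP; rewrite -subr_eq0.
  apply/eqP/dot_eq0.
  by rewrite /dot /= !(mulfI z0 e1, mulfI z0 e2, mulfI z0 e3) !subrr !mulr0 !addr0.
have x_ge0 := sinc_form_ge0 P x; have w_ge0 := sinc_form_ge0 P w.
have x0 := @sinc_form_eq0 _ _ P x Pinj (ltac:(lra)).
have w0 := @sinc_form_eq0 _ _ P w Pinj (ltac:(lra)).
move/eqP: v0; apply; apply/rowP => j; rewrite mxE.
by apply/eqP; rewrite eq_complex; apply/andP; split; apply/eqP; [exact: x0|exact: w0].
Qed.
End GammaOnRealAxis.

Theorem theorem2p6 (R : realType) (N : nat) (hN : (1 <= N)%N)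
    (alpha : 'I_N -> R) (Y : 'I_N -> R * R * R) (hY : injective Y) :
  (forall z : R, z != 0 -> Gamma alpha Y z%:C%C \in unitmx) /\
  (forall w : R[i], 0 < complex.Im w -> ~ upper_poles alpha Y w ->
   forall z : R, z != 0 -> ~ resonance_at_sqr alpha Y w z%:C%C).
Proof.
split=> [z z0|w _ _ z z0 [/negP singular _]]; first exact: Gamma_real_unitmx.
by apply: singular; exact: Gamma_real_unitmx.
Qed.
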